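(* Let $E\in\mathbb{R}^{s\times s}$ be nilpotent and let $\hat W_0\in\mathcal{D}^s$. Let $K=K^{\sf T}\in\mathbb{R}^{s\times s}$ satisfy $\mathcal{L}_E(K)=0$, and let $N=N^{\sf T}\in\mathbb{R}^{s\times s}$ be such that $\mathcal{P}_E(N)=\hat M_{11}$ with $\hat M_{11}\in\mathcal{L}_E(\mathcal{D}_0^s)\cap\mathcal{D}_0^s$. Assume that $\hat W:=\hat W_0-K-N\in\mathcal{D}^s$. Then, for any matrix $\hat M_{12}\in\mathbb{R}^{s\times s}$ such that $$\hat{\mathbb{M}}:=\begin{pmatrix}\hat M_{11}&\hat M_{12}\\ \hat M_{12}^{\sf T}&\hat W\end{pmatrix}\in\mathcal{D}_0^{2s},$$ the triple of matrices $$\hat Z=\Phi_E(\hat W_0),\qquad \hat W=\hat W_0-K-N,\qquad H=E+\hat Z^{-1}(\hat W+\hat M_{12})$$ is a feasible solution, i.e. $\mathcal{M}(E,H,\hat W,\hat Z)\succeq0$, with $\hat Z\succ0$.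
   Context: $\mathcal{D}^s$ (resp. $\mathcal{D}_0^s$) denotes the set of real symmetric positive definite (resp. positive semi-definite) $s\times s$ matrices; $X\succ0$, $X\succeq0$ denote positive definiteness and semi-definiteness of symmetric matrices. For a nilpotent $E\in\mathbb{R}^{s\times s}$ put $\Theta=e^E$ and define the linear maps on $\mathbb{R}^{s\times s}$ $$\mathcal{L}_E(X)=XE+E^{\sf T}X,\quad \mathcal{P}_E(X)=\Theta^{\sf T}X\Theta-X,\quad \Phi_E(X)=\int_0^1e^{tE^{\sf T}}Xe^{tE}\,dt.$$ For $H\in\mathbb{R}^{s\times s}$ and symmetric $\hat W,\hat Z\in\mathbb{R}^{s\times s}$ the test matrix is $$\mathcal{M}(E,H,\hat W,\hat Z):=\begin{pmatrix}\mathcal{L}_E(\hat Z)-\mathcal{P}_E(\hat W)&\hat W-\hat Z(H-E)\\ \hat W-(H-E)^{\sf T}\hat Z&\hat W\end{pmatrix}\in\mathbb{R}^{2s\times2s}.$$ *)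

(* Defs.v *)
From HB Require Import structures.
From mathcomp Require Import all_boot all_order all_algebra.
From mathcomp Require Import all_classical all_reals all_analysis.

Set Implicit Arguments.
Unset Strict Implicit.
Unset Printing Implicit Defensive.

Import Order.TTheory GRing.Theory Num.Theory.
Import numFieldNormedType.Exports.

Local Open Scope classical_set_scope.
Local Open Scope ring_scope.

Definition posdefmx {R : realType} {s : nat} : set 'M[R]_s :=
  [set X | X^T = X /\
           forall v : 'cV[R]_s, v != 0 -> 0 < (v^T *m X *m v) 0 0].

Definition possemidefmx {R : realType} {s : nat} : set 'M[R]_s :=
  [set X | X^T = X /\
           forall v : 'cV[R]_s, 0 <= (v^T *m X *m v) 0 0].

Definition nilpotentmx {R : realType} {s : nat} (E : 'M[R]_s) : Prop :=
  exists k : nat, E ^+ k = 0.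

Definition expmx {R : realType} {s : nat} (A : 'M[R]_s) : 'M[R]_s :=
  limn (series (fun k : nat => (k`!%:R)^-1 *: A ^+ k)).

Section Maps.
Context {R : realType} {s : nat}.
Implicit Types E X : 'M[R]_s.

Definition Lmap E X : 'M[R]_s := X *m E + E^T *m X.

Definition Pmap E X : 'M[R]_s := (expmx E)^T *m X *m expmx E - X.

(* The matrix-valued integral is taken entry by entry. *)
Definition Phimap E X : 'M[R]_s :=
  \matrix_(i, j) \int[lebesgue_measure]_(t in `[0, 1])
    ((expmx (t *: E^T) *m X *m expmx (t *: E)) i j).

Definition testmx E (H W Z : 'M[R]_s) : 'M[R]_(s + s) :=
  block_mx (Lmap E Z - Pmap E W)  (W - Z *m (H - E))
           (W - (H - E)^T *m Z)   W.

End Maps.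

(* Main.v *)
(* By the choice of H, Z (H - E) = W + M12, so the off-diagonal blocks of the
   test matrix are -M12 and its transpose. The derivative of
   F(t) = e^(tE)^T W0 e^(tE) is L_E(F(t)), hence L_E(Phi_E(W0)) = P_E(W0); it is
   also e^(tE)^T L_E(W0) e^(tE), hence P_E = Phi_E o L_E and P_E(K) = 0. The
   upper left block is thus P_E(W0) - P_E(W) = P_E(N) = M11, and the test matrix
   is congruent to the given semidefinite one by a change of sign. Since E is
   nilpotent, e^(tE) is a polynomial in t, so the calculus takes place on
   matrices of polynomials. *)

Require Import Defs.
From HB Require Import structures.
From mathcomp Require Import all_boot all_order all_algebra.
From mathcomp Require Import all_classical all_reals all_analysis.

Set Implicit Arguments.
Unset Strict Implicit.
Unset Printing Implicit Defensive.

Import Order.TTheory GRing.Theory Num.Theory.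
Import numFieldNormedType.Exports.

Local Open Scope classical_set_scope.
Local Open Scope ring_scope.

(** * Integrals of polynomials over the unit interval *)

Section PolynomialIntegral.
Context {R : realType}.
Implicit Types p q : {poly R}.

Definition int01 p : R := \int[lebesgue_measure]_(t in `[0, 1]) p.[t].

Lemma integrable_horner p :
  (@lebesgue_measure R).-integrable `[0, 1] (EFin \o horner p).
Proof.
apply: continuous_compact_integrable; first exact: segment_compact.
exact/continuous_subspaceT/continuous_horner.
Qed.

Lemma int01_is_linear : linear_for *%R int01.
Proof.
move=> a p q; rewrite /int01 -RintegralZl//; last exact: integrable_horner.
rewrite -RintegralD//; last 2 first.
- have -> : EFin \o (fun x => a * p.[x]) = EFin \o horner (a *: p).
    by apply/funext => x /=; rewrite hornerZ.
  exact: integrable_horner.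
- exact: integrable_horner.
by apply: eq_Rintegral => x _; rewrite !hornerE.
Qed.

HB.instance Definition _ :=
  GRing.isLinear.Build R {poly R} R *%R int01 int01_is_linear.

Lemma int01_deriv p : int01 p^`() = p.[1] - p.[0].
Proof.
rewrite /int01 /Rintegral (@continuous_FTC2 _ _ (horner p))//.
- exact/continuous_subspaceT/continuous_horner.
- split => /=.
  + by move=> x _; exact: derivable_horner.
  + exact/cvg_at_right_filter/continuous_horner.
  + exact/cvg_at_left_filter/continuous_horner.
- by move=> x _; rewrite derivE.
Qed.

(** By compactness [p] attains its minimum on the unit interval; this value is positive and bounds
    the integral from below. *)
Lemma int01_gt0 p : (forall t, 0 < p.[t]) -> 0 < int01 p.
Proof.
move=> p_gt0.
have [//|c _ c_min] := @EVT_min R (horner p) 0 1 ler01.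
  exact/continuous_subspaceT/continuous_horner.
apply: (lt_le_trans (p_gt0 c)).
(* The minimum is turned into the integral of a constant polynomial, through its antiderivative, so
   that monotonicity of the integral applies. *)
have -> : p.[c] = int01 ('X * p.[c]%:P)^`().
  by rewrite int01_deriv !hornerE subr0.
have -> : ('X * p.[c]%:P)^`() = p.[c]%:P.
  by rewrite derivM derivX derivC mulr0 addr0 mul1r.
apply: le_Rintegral => //; try exact: integrable_horner.
by move=> t t01; rewrite hornerC; apply: c_min.
Qed.

Lemma map_int01_mulmx m n u v (A : 'M[R]_(m, n)) (Q : 'M[{poly R}]_(n, u))
    (B : 'M[R]_(u, v)) :
  map_mx int01 (map_mx polyC A *m Q *m map_mx polyC B) =
  A *m map_mx int01 Q *m B.
Proof.
apply/matrixP => i j; rewrite !mxE raddf_sum; apply: eq_bigr => k _ /=.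
rewrite !mxE mulrC mul_polyC linearZ/= mulrC raddf_sum; congr (_ * _).
by apply: eq_bigr => l _ /=; rewrite !mxE mul_polyC linearZ.
Qed.

End PolynomialIntegral.

(** * Entrywise derivative and evaluation of polynomial matrices *)

Section MatrixDerivative.
Context {R : comNzRingType}.

Lemma map_deriv_mulmx m n p (A : 'M[{poly R}]_(m, n)) (B : 'M[{poly R}]_(n, p)) :
  map_mx (@deriv R) (A *m B) =
  map_mx (@deriv R) A *m B + A *m map_mx (@deriv R) B.
Proof.
apply/matrixP => i j; rewrite !mxE raddf_sum -big_split/=.
by apply: eq_bigr => k _; rewrite !mxE derivM.
Qed.

Lemma map_deriv_polyC m n (A : 'M[R]_(m, n)) :
  map_mx (@deriv R) (map_mx polyC A) = 0.
Proof. by apply/matrixP => i j; rewrite !mxE derivC. Qed.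

Lemma map_horner_polyC m n (t : R) (A : 'M[R]_(m, n)) :
  map_mx (horner_eval t) (map_mx polyC A) = A.
Proof. by apply/matrixP => i j; rewrite !mxE /horner_eval hornerC. Qed.

End MatrixDerivative.

(** * The exponential of a nilpotent matrix *)

Section NilpotentExponential.
Context {R : realType} {s : nat}.
Implicit Types (E X : 'M[R]_s) (k : nat) (t : R).

(** The partial sums of the series are constant from index [k] on. *)
Lemma expmx_nilp E k : E ^+ k = 0 ->
  expmx E = \sum_(j < k) (j`!%:R)^-1 *: E ^+ j.
Proof.
move=> Ek; rewrite /expmx; apply: lim_near_cst; first exact: norm_hausdorff.
near=> n; have kn : (k <= n)%N by near: n; exact: nbhs_infty_ge.
rewrite /series/= (big_cat_nat (leq0n k) kn)//= big_mkord [X in _ + X]big_nat_cond.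
rewrite [X in _ + X]big1 ?addr0// => j /andP[/andP[kj _] _].
by rewrite -(subnKC kj) exprD Ek mul0r scaler0.
Unshelve. all: by end_near. Qed.

Lemma trmx_expr E k : (E ^+ k)^T = E^T ^+ k.
Proof.
elim: k => [|k IH]; first by rewrite !expr0 trmx1.
by rewrite exprS exprSr -IH; exact: trmx_mul.
Qed.

Lemma trmx_expmx E k : E ^+ k = 0 -> (expmx E)^T = expmx E^T.
Proof.
move=> Ek; rewrite (expmx_nilp Ek) (@expmx_nilp _ k); last first.
  by rewrite -trmx_expr Ek trmx0.
rewrite linear_sum/=; apply: eq_bigr => j _.
by rewrite linearZ/= trmx_expr.
Qed.

(* [exprZn] does not apply: ['M_s] is an algebra only for [s = s'.+1]. *)
Lemma exprZmx E k t : (t *: E) ^+ k = t ^+ k *: E ^+ k.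
Proof.
elim: k => [|k IH]; first by rewrite !expr0 scale1r.
rewrite !exprS IH -[LHS]/(_ *m _) -[E * _]/(E *m _).
by rewrite -scalemxAl -scalemxAr scalerA.
Qed.

(* When [E ^+ k = 0], this is [e^(tE)] as a matrix of polynomials in [t]. *)
Definition expmx_poly E k : 'M[{poly R}]_s :=
  \sum_(j < k) ((j`!%:R)^-1 *: 'X^j) *: map_mx polyC (E ^+ j).

Lemma expmx_poly_horner E k t : E ^+ k = 0 ->
  expmx (t *: E) = map_mx (horner_eval t) (expmx_poly E k).
Proof.
move=> Ek; rewrite (@expmx_nilp _ k); last by rewrite exprZmx Ek scaler0.
rewrite /expmx_poly raddf_sum; apply: eq_bigr => j _ /=.
apply/matrixP => a b; rewrite !mxE /horner_eval !hornerE exprZmx !mxE.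
by rewrite mulrA.
Qed.

Lemma comm_expmx_poly E k :
  map_mx polyC E *m expmx_poly E k = expmx_poly E k *m map_mx polyC E.
Proof.
rewrite mulmx_sumr mulmx_suml; apply: eq_bigr => j _.
rewrite -scalemxAr -scalemxAl -!map_mxM; congr (_ *: map_mx _ _).
exact: (commrX j (commr_refl E)).
Qed.

Lemma deriv_expmx_poly E k : E ^+ k = 0 ->
  map_mx (@deriv R) (expmx_poly E k) = map_mx polyC E *m expmx_poly E k.
Proof.
case: k => [|k] Ek.
  rewrite /expmx_poly !big_ord0 mulmx0.
  by apply/matrixP => i j; rewrite !mxE deriv0.
(* On the right the last term carries [E ^+ k.+1 = 0]; on the left the constant term has derivative
   zero. The remaining terms agree after an index shift. *)
rewrite {2}/expmx_poly mulmx_sumr big_ord_recr/= -scalemxAr -map_mxM/=.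
rewrite -[E *m _]/(E * _) -exprS Ek map_mx0 scaler0 addr0.
rewrite /expmx_poly big_ord_recl/= raddfD/= raddf_sum.
rewrite [X in X + _](_ : _ = 0) ?add0r; last first.
  apply/matrixP => i j.
  by rewrite !mxE mulrC mul_polyC !derivZ derivXn mulr0n !scaler0.
apply: eq_bigr => j _ /=.
rewrite -scalemxAr -map_mxM/= -[E *m _]/(E * _) -exprS.
apply/matrixP => a b; rewrite !mxE mulrC mul_polyC !derivZ derivXn.
rewrite mulrC mul_polyC /bump leq0n add1n/= -(scaler_nat _ 'X^j) !scalerA.
congr (_ *: _).
by rewrite factS natrM invfM -!mulrA [_^-1 * j.+1%:R]mulrC mulKf// pnatr_eq0.
Qed.

End NilpotentExponential.

(** * The identities between [Lmap], [Pmap] and [Phimap], and positivity of [Phimap] *)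

Section LyapunovMaps.
Context {R : realType} {s : nat}.
Implicit Types (E X : 'M[R]_s) (k : nat) (t : R).

(** The curve [e^(tE)^T X e^(tE)] as a polynomial matrix in [t], provided [E ^+ k = 0]. *)
Definition expconj_poly E X k : 'M[{poly R}]_s :=
  (expmx_poly E k)^T *m map_mx polyC X *m expmx_poly E k.

Lemma expconj_poly_horner E X k t : E ^+ k = 0 ->
  map_mx (horner_eval t) (expconj_poly E X k) =
  (expmx (t *: E))^T *m X *m expmx (t *: E).
Proof.
move=> Ek; rewrite /expconj_poly 2!map_mxM/= -map_trmx.
by rewrite -(expmx_poly_horner t Ek) map_horner_polyC.
Qed.

Lemma Phimap_int01 E X k : E ^+ k = 0 ->
  Phimap E X = map_mx int01 (expconj_poly E X k).
Proof.
move=> Ek; apply/matrixP => i j; rewrite [LHS]mxE [RHS]mxE; apply: eq_Rintegral => t _.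
rewrite -linearZ/= -(@trmx_expmx _ _ _ k); last by rewrite exprZmx Ek scaler0.
by rewrite -(expconj_poly_horner X t Ek) mxE.
Qed.

(** The fundamental theorem of calculus: the curve runs from [X] at [t = 0] to [e^E^T X e^E] at
    [t = 1]. *)
Lemma Pmap_int01 E X k : E ^+ k = 0 ->
  Pmap E X = map_mx int01 (map_mx (@deriv R) (expconj_poly E X k)).
Proof.
move=> Ek; have e0 : expmx (0 *: E) = 1%:M.
  rewrite scale0r (@expmx_nilp _ _ _ 1) ?expr1// big_ord1 expr0.
  by rewrite fact0 invr1 scale1r.
transitivity (map_mx (horner_eval 1) (expconj_poly E X k) -
              map_mx (horner_eval 0) (expconj_poly E X k)).
  by rewrite !expconj_poly_horner// e0 trmx1 mul1mx mulmx1 scale1r.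
by apply/matrixP => i j; rewrite !mxE int01_deriv.
Qed.

(** With the derivative of [e^(tE)] written as [E e^(tE)], the product rule puts [E] and [E^T] next
    to [X]. *)
Lemma deriv_expconj_poly E X k : E ^+ k = 0 ->
  map_mx (@deriv R) (expconj_poly E X k) = expconj_poly E (Lmap E X) k.
Proof.
move=> Ek; rewrite /expconj_poly !map_deriv_mulmx map_deriv_polyC mulmx0 addr0.
rewrite -map_trmx (deriv_expmx_poly Ek) /Lmap map_mxD !map_mxM/= -map_trmx.
by rewrite mulmxDr mulmxDl trmx_mul !mulmxA addrC.
Qed.

(** As [E] commutes with [e^(tE)], the inner factors [E] and [E^T] can be moved to the outside. *)
Lemma expconj_poly_Lmap E X k :
  expconj_poly E (Lmap E X) k =
  expconj_poly E X k *m map_mx polyC E +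
  map_mx polyC E^T *m expconj_poly E X k.
Proof.
rewrite /expconj_poly /Lmap map_mxD !map_mxM/= mulmxDr mulmxDl.
rewrite -!mulmxA comm_expmx_poly !mulmxA; congr (_ + _ *m _ *m _).
by rewrite -map_trmx -!trmx_mul comm_expmx_poly.
Qed.

Lemma Phimap_Lmap E X : nilpotentmx E -> Phimap E (Lmap E X) = Pmap E X.
Proof.
move=> [k Ek].
by rewrite (Phimap_int01 _ Ek) (Pmap_int01 _ Ek) deriv_expconj_poly.
Qed.

(** Once [E] and [E^T] stand outside, they are constant factors and leave the integral. *)
Lemma Lmap_Phimap E X : nilpotentmx E -> Lmap E (Phimap E X) = Pmap E X.
Proof.
move=> nE; rewrite -Phimap_Lmap//; case: nE => k Ek.
rewrite !(Phimap_int01 _ Ek) expconj_poly_Lmap map_mxD/=.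
have := map_int01_mulmx 1%:M (expconj_poly E X k) E.
have := map_int01_mulmx E^T (expconj_poly E X k) 1%:M.
by rewrite !map_mx1 !mul1mx !mulmx1 => -> ->.
Qed.

Lemma Phimap0 E : Phimap E 0 = 0.
Proof.
apply/matrixP => i j; rewrite !mxE -[RHS](linear0 int01).
by apply: eq_Rintegral => t _; rewrite mulmx0 mul0mx mxE horner0.
Qed.

Lemma Pmap_eq0 E X : nilpotentmx E -> Lmap E X = 0 -> Pmap E X = 0.
Proof. by move=> nE LX; rewrite -Phimap_Lmap// LX Phimap0. Qed.

(** Write [e^E = 1 + E S], with [S] a polynomial in [E]. Then [v = - E S v], and iterating gives
    [v = 0] because [E S] is nilpotent. *)
Lemma expmx_nilp_mulmx_eq0 E (v : 'cV[R]_s) :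
  nilpotentmx E -> expmx E *m v = 0 -> v = 0.
Proof.
move=> [[|k] Ek].
  by move=> _; rewrite -[v]mul1mx -[1%:M](expr0 E) Ek mul0mx.
rewrite (expmx_nilp Ek) big_ord_recl/= fact0 invr1 scale1r expr0 mulmxDl mul1mx.
pose S := \sum_(j < k) (j.+1`!%:R)^-1 *: E ^+ j.
have -> : \sum_(j < k) (j.+1`!%:R)^-1 *: E ^+ j.+1 = E * S.
  rewrite -[RHS]/(E *m S) /S mulmx_sumr; apply: eq_bigr => j _.
  by rewrite -scalemxAr exprS.
have cES : GRing.comm E S.
  rewrite /GRing.comm -[LHS]/(E *m S) -[RHS]/(S *m E) mulmx_sumr mulmx_suml.
  apply: eq_bigr => j _; rewrite -scalemxAr -scalemxAl; congr (_ *: _).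
  exact: (commrX j (commr_refl E)).
move=> /eqP; rewrite addr_eq0 => /eqP v_eq.
have {}v_eq : v = (- (E * S)) *m v by rewrite mulNmx.
have it n : v = (- (E * S)) ^+ n *m v.
  elim: n => [|n IH]; first by rewrite expr0 mul1mx.
  by rewrite exprSr -[_ * - _]/(_ *m _) -mulmxA -v_eq.
by rewrite (it k.+1) exprNn exprMn_comm// Ek mul0r mulr0 mul0mx.
Qed.

(** The quadratic form at [v] is the integral of [w^T X w] with [w = e^(tE) v], which is nonzero for
    every [t]. *)
Lemma posdef_Phimap E X : nilpotentmx E -> posdefmx X -> posdefmx (Phimap E X).
Proof.
move=> [k Ek] [symX X_gt0]; split.
  rewrite (Phimap_int01 _ Ek) map_trmx; congr map_mx.
  by rewrite /expconj_poly !trmx_mul trmxK map_trmx symX mulmxA.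
move=> v v0; rewrite (Phimap_int01 _ Ek) -map_int01_mulmx mxE.
apply: int01_gt0 => t.
set Q := expconj_poly E X k; set w := expmx (t *: E) *m v.
rewrite (_ : _.[t] = (w^T *m X *m w) 0 0).
  apply: X_gt0; apply: contra_neq v0; apply: expmx_nilp_mulmx_eq0.
  by exists k; rewrite exprZmx Ek scaler0.
have -> : w^T *m X *m w = v^T *m map_mx (horner_eval t) Q *m v.
  by rewrite expconj_poly_horner// trmx_mul !mulmxA.
rewrite -[X in _ = (X *m _ *m _) 0 0](map_horner_polyC t).
rewrite -[X in _ = (_ *m X) 0 0](map_horner_polyC t).
by rewrite -!map_mxM [RHS]mxE.
Qed.

End LyapunovMaps.

(** * Definite matrices and assembly of the test matrix *)

Lemma posdefmx_unit (R : realType) (s : nat) (X : 'M[R]_s) :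
  posdefmx X -> X \in unitmx.
Proof.
move=> [_ X_gt0]; rewrite -row_free_unit -kermx_eq0.
apply/eqP/row_matrixP => i; rewrite row0; apply/eqP/negP => /negP u0.
have uX : row i (kermx X) *m X = 0 by apply/sub_kermxP; exact: row_sub.
have := X_gt0 (row i (kermx X))^T.
by rewrite trmx_eq0 => /(_ u0); rewrite trmxK uX mul0mx mxE ltxx.
Qed.

(** The new form at [(x, y)] is the old one at [(x, -y)]. *)
Lemma possemidefmx_oppr_offdiag (R : realType) (m n : nat) (A : 'M[R]_m)
    (B : 'M[R]_(m, n)) (D : 'M[R]_n) :
  possemidefmx (block_mx A B B^T D) ->
  possemidefmx (block_mx A (- B) (- B)^T D).
Proof.
rewrite /possemidefmx/= !tr_block_mx !trmxK => -[/eq_block_mx[-> _ _ ->] ge0].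
split=> // v; have := ge0 (col_mx (usubmx v) (- dsubmx v)).
rewrite -[v in X in _ -> X]vsubmxK !tr_col_mx !mul_row_block !mul_row_col.
by rewrite !linearN/= !mulmxDl !mulNmx opprD opprK.
Qed.

Theorem lemma3p9 (R : realType) (s : nat) (E W0 K N M11 : 'M[R]_s) :
  nilpotentmx E ->
  posdefmx W0 ->
  K^T = K -> Lmap E K = 0 ->
  N^T = N -> Pmap E N = M11 ->
  ((Lmap E @` possemidefmx) `&` possemidefmx) M11 ->
  let W := W0 - K - N in
  posdefmx W ->
  forall M12 : 'M[R]_s,
  possemidefmx (block_mx M11 M12 M12^T W) ->
  let Z := Phimap E W0 in
  let H := E + invmx Z *m (W + M12) in
  possemidefmx (testmx E H W Z) /\ posdefmx Z.
Proof.
move=> nE W0_gt0 symK LK symN PN _ W W_gt0 M12 M_ge0 Z H.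
have Z_gt0 : posdefmx Z by exact: posdef_Phimap.
split=> //.
have ZH : Z *m (H - E) = W + M12.
  by rewrite /H addrAC subrr add0r mulmxA mulmxV ?mul1mx// posdefmx_unit.
have [symZ _] := Z_gt0; have [symW _] := W_gt0.
have HZ : (H - E)^T *m Z = W + M12^T.
  by rewrite -{1}symZ -trmx_mul ZH linearD/= symW.
have PW : Pmap E W = Pmap E W0 - M11.
  (* The inserted zero becomes [Pmap E K], so that additivity of [Pmap] closes the goal. *)
  rewrite -PN -[Pmap E W0]subr0 -(Pmap_eq0 nE LK) /W.
  have PB A B : Pmap E (A - B) = Pmap E A - Pmap E B.
    by rewrite /Pmap mulmxBr mulmxBl !opprB addrACA [RHS]addrACA [X in _ + X = _]addrC.
  by rewrite !PB.
rewrite /testmx ZH HZ Lmap_Phimap// PW opprB addrC subrK.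
have opprD_cancel (A : 'M[R]_s) : W - (W + A) = - A by rewrite opprD addNKr.
rewrite !opprD_cancel -linearN; exact: possemidefmx_oppr_offdiag.
Qed.
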